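(* Let $1<p,q<\infty$. The space $X=\bigoplus_{\ell_p}\ell_q^n$ admits a separating polynomial if and only if $p$ and $q$ are both even integers and $p=kq$ for some $k\in\mathbb{N}$.
   Context: $\bigoplus_{\ell_p}\ell_q^n$ is the space of sequences $x=(x_n)_{n\ge1}$ with $x_n\in\ell_q^n$ and $\|x\|=(\sum_n\|x_n\|_q^p)^{1/p}<\infty$. A separating polynomial is a continuous polynomial $P$ with $P(0)=0$ and $P(x)\ge1$ for all $\|x\|=1$. *)

(* Defs.v *)
From HB Require Import structures.
From mathcomp Require Import all_boot all_order all_algebra.
From mathcomp Require Import all_classical all_reals all_analysis.
Set Implicit Arguments. Unset Strict Implicit. Unset Printing Implicit Defensive.
Import Order.TTheory GRing.Theory Num.Theory numFieldNormedType.Exports.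
Local Open Scope ring_scope.

(* Ambient sequence space: x n is the n-th block, a vector of R^n (indices 'I_n).
   Block 0 is the trivial space R^0, so the blocks are effectively l_q^n, n >= 1. *)
Definition seqE (R : realType) := forall n : nat, 'I_n -> R.

Definition addE (R : realType) (x y : seqE R) : seqE R := fun n i => x n i + y n i.
Definition scaleE (R : realType) (a : R) (x : seqE R) : seqE R := fun n i => a * x n i.
Definition subE (R : realType) (x y : seqE R) : seqE R := fun n i => x n i - y n i.
Definition zeroE (R : realType) : seqE R := fun n i => 0.

Definition blocknorm (R : realType) (q : R) (x : seqE R) (n : nat) : R :=
  powR (\sum_(i < n) powR `|x n i| q) q^-1.

Definition psums (R : realType) (p q : R) (x : seqE R) : nat -> R :=
  series (fun n => powR (blocknorm q x n) p).

Definition inX (R : realType) (p q : R) (x : seqE R) : Prop := cvgn (psums p q x).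

Definition normX (R : realType) (p q : R) (x : seqE R) : R :=
  powR (limn (psums p q x)) p^-1.

Definition upd (R : realType) (k : nat) (v : 'I_k -> seqE R) (j : 'I_k) (w : seqE R)
  : 'I_k -> seqE R := fun i => if i == j then w else v i.

Definition multilinear (R : realType) (p q : R) (k : nat) (A : ('I_k -> seqE R) -> R) : Prop :=
  forall (v : 'I_k -> seqE R) (j : 'I_k) (y z : seqE R) (a b : R),
    (forall i, inX p q (v i)) -> inX p q y -> inX p q z ->
    A (upd v j (addE (scaleE a y) (scaleE b z))) = a * A (upd v j y) + b * A (upd v j z).

Definition polynomialX (R : realType) (p q : R) (P : seqE R -> R) : Prop :=
  exists (d : nat) (A : forall k : nat, ('I_k -> seqE R) -> R),
    (forall k, multilinear p q (A k)) /\
    (forall x, inX p q x -> P x = \sum_(k < d.+1) A k (fun _ => x)).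

Definition continuousX (R : realType) (p q : R) (P : seqE R -> R) : Prop :=
  forall x, inX p q x -> forall e : R, 0 < e -> exists2 delta : R, 0 < delta &
    forall y, inX p q y -> normX p q (subE y x) < delta -> `|P y - P x| < e.

Definition separating_polynomial (R : realType) (p q : R) (P : seqE R -> R) : Prop :=
  [/\ polynomialX p q P, continuousX p q P, P (zeroE R) = 0 &
      forall x, inX p q x -> normX p q x = 1 -> 1 <= P x].

Definition even_integer (R : realType) (r : R) : Prop := exists m : nat, r = (2 * m)%:R.

(* Main.v *)
Require Import Defs.
From HB Require Import structures.
From mathcomp Require Import all_boot all_order all_algebra.
From mathcomp Require Import all_classical all_reals all_analysis.
From mathcomp Require Import ring lra zify.
Import Order.TTheory GRing.Theory Num.Theory numFieldNormedType.Exports.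
Set Implicit Arguments. Unset Strict Implicit. Unset Printing Implicit Defensive.
Local Open Scope ring_scope.

(** Let [P] be separating, hence bounded on balls. Evaluate it on matrices [c] placed
in the space, either with rows in distinct blocks (mass [\sum_b (\sum_l |c b l|^q)^(p/q)],
exponent [rho = p]) or inside one block (same formula with [rho = q]). Averaging the
increment [P (x + y) - P x] over the flat perturbations [y] supported by a rectangle
in fresh rows, with a random sign, gives a function polynomial in the dimensions of
the rectangle; boundedness for all dimensions bounds the growth of its coefficients.
The part of the increment which is linear in the number of rows can survive for
rectangles of small height only in degree [rho] in [y], and only if [rho] is even and
[rho / q] is an integer. Otherwise a perturbation of mass [1/K] can be chosen that
increases [P] by at most [O(1/K^2)], and [K] of them lead from [0] to a unit vector
where [P <= O(1/K) < 1]. Conversely, if [q] is even and [p = k * q], the [p]-th power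
of the norm is a polynomial. *)

(** * Coefficients of polynomials and random subsets *)

(** The values at the nodes [t, 2t, ..., (d+1)t] determine the scaled coefficients [a k * t ^+ k]
    through an inverse Vandermonde matrix that does not depend on [t]; [C] is the sum of the
    absolute values of its entries. *)
Lemma coef_bound (R : realFieldType) (d : nat) :
  exists2 C : R, 0 <= C & forall (a : nat -> R) (B t : R), 0 < t ->
    (forall i : nat, (0 < i <= d.+1)%N ->
       `|\sum_(k < d.+1) a k * (i%:R * t) ^+ k| <= B) ->
    forall k : nat, (k <= d)%N -> `|a k| * t ^+ k <= C * B.
Proof.
pose V : 'M[R]_d.+1 := Vandermonde d.+1 (\row_j (j.+1)%:R).
have Vu : V \in unitmx.
  rewrite unitmxE unitfE det_Vandermonde; apply/prodf_neq0 => i _.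
  apply/prodf_neq0 => j ij; rewrite !mxE subr_eq0 eqr_nat eqSS.
  by rewrite neq_ltn ij orbT.
exists (\sum_i \sum_k `|invmx V i k|).
  by apply: sumr_ge0 => i _; apply: sumr_ge0.
move=> a B t t0 aB k kd; pose u : 'rV[R]_d.+1 := \row_k (a k * t ^+ k).
have uE : u = (u *m V) *m invmx V by rewrite mulmxK.
pose k' : 'I_d.+1 := Ordinal (kd : (k < d.+1)%N).
have -> : `|a k| * t ^+ k = `|u 0 k'|.
  by rewrite mxE normrM (ger0_norm (exprn_ge0 _ (ltW t0))).
have uV j : `|(u *m V) 0 j| <= B.
  have := aB j.+1; rewrite ltn_ord => /(_ isT); congr (_ <= _).
  rewrite mxE; congr (`| _ |); apply: eq_bigr => i _.
  by rewrite !mxE exprMn mulrA mulrAC.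
have B0 : 0 <= B := le_trans (normr_ge0 _) (uV ord0).
rewrite uE mxE (le_trans (ler_norm_sum _ _ _)) // mulr_suml ler_sum // => i _.
rewrite normrM mulrC ler_pM //.
by rewrite (bigD1 k') //= lerDl sumr_ge0.
Qed.

(* The growth bound is used at the scales [1] and [delta ^ 2]; one of them is
   far below, the other far above [delta], so only the exponent [r = a] can
   contribute at the scale [delta]. *)
Lemma growth_coef_bound (R : realType) (d : nat) (a : R) : 0 <= a ->
  exists2 C : R, 0 <= C & forall (g : nat -> R) (B : R) (delta : nat),
    (0 < delta)%N ->
    (forall i : nat, (0 < i <= d.+1 * delta ^ 2)%N ->
       `|\sum_(r < d.+1) g r * i%:R ^+ r| <= B * i%:R `^ a) ->
    forall r, (r <= d)%N ->
      `|g r| * delta%:R `^ (r%:R - a) <= C * B * delta%:R `^ (- `|r%:R - a|).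
Proof.
move=> a0; have [C C0 HC] := coef_bound R d.
exists (C * d.+1%:R `^ a); first by rewrite mulr_ge0 ?powR_ge0.
move=> g B delta delta0 gB r rd.
have B0 : 0 <= B.
  have := gB 1%N; rewrite ?powR1 ?mulr1 => H; apply: le_trans (H _) => //.
  by rewrite muln_gt0 expn_gt0 delta0.
(* Sampling at the multiples [s, 2s, ..., (d+1)s], which stay in the allowed range because
   [s <= delta ^ 2]. *)
have key s : (0 < s <= delta ^ 2)%N ->
    `|g r| <= C * d.+1%:R `^ a * B * s%:R `^ (a - r%:R).
  move=> /andP[s0 sd].
  have s0' : 0 < s%:R :> R by rewrite ltr0n.
  have := HC g (B * (d.+1%:R * s%:R) `^ a) s%:R s0'.
  move=> /(_ _ r rd); rewrite powRB ?(gt_eqF s0') ?implybT//; rewrite powR_mulrn ?ler0n// powRM ?ler0n// => H.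
  rewrite mulrA ler_pdivlMr ?exprn_gt0//.
  apply: le_trans (H _) _; last by rewrite le_eqVlt; apply/orP; left; apply/eqP; ring.
  move=> i /andP[i0 id]; rewrite -natrM.
  apply: le_trans (gB (i * s)%N _) _.
    by rewrite muln_gt0 i0 s0 /= leq_mul.
  rewrite ler_wpM2l// -powRM ?ler0n// ge0_ler_powR ?nnegrE ?ler0n// -?natrM ?ler_nat ?ler0n//.
  by rewrite leq_mul.
have d0 : 0 < delta%:R :> R by rewrite ltr0n.
have [ra|ra] := leP a r%:R.
- rewrite (ger0_norm (_ : 0 <= r%:R - a)) ?subr_ge0//.
  have := key (delta ^ 2)%N; rewrite expn_gt0 delta0 leqnn => /(_ isT) H.
  apply: le_trans (ler_wpM2r (powR_ge0 _ _) H) _.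
  rewrite -[leLHS]mulrA ler_wpM2l ?mulr_ge0 ?powR_ge0//.
  rewrite natrX -powR_mulrn ?ler0n// -powRrM -powRD; last by rewrite (gt_eqF d0) implybT.
  by rewrite le_eqVlt; apply/orP; left; apply/eqP; congr (_ `^ _); ring.
- rewrite (ltr0_norm (_ : r%:R - a < 0)) ?subr_lt0// opprK ler_wpM2r ?powR_ge0//.
  have := key 1%N; rewrite powR1 mulr1; apply.
  by rewrite expn_gt0 delta0.
Qed.

(** Up to the factor ['C(N, m)], this is the probability that a random [m]-subset contains [B].
    Taking complements, one counts the subsets of size [N - m] of the complement of [B]. *)
Lemma sum_subset_draws (R : numFieldType) (N m : nat) (B : {set 'I_N}) :
  (m <= N)%N ->
  \sum_(S : {set 'I_N} | #|S| == m) (B \subset S)%:R =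
  'C(N, m)%:R * ((m ^_ #|B|)%:R / (N ^_ #|B|)%:R) :> R.
Proof.
move=> mN.
have BN : (#|B| <= N)%N by rewrite -[leqRHS]card_ord max_card.
have fN : (N ^_ #|B|)%:R != 0 :> R by rewrite pnatr_eq0 -lt0n ffact_gt0.
have -> : \sum_(S : {set 'I_N} | #|S| == m) (B \subset S)%:R =
    'C(N - #|B|, N - m)%:R :> R.
  have -> : (N - #|B|)%N = #|~: B| by rewrite (cardsCs (~: B)) finset.setCK card_ord.
  rewrite -cards_draws -sum1_card natr_sum.
  rewrite (reindex_inj (inv_inj (@finset.setCK _))) /=.
  rewrite [RHS]big_mkcond [LHS]big_mkcond /=; apply: eq_bigr => S _.
  rewrite inE finset.subsetC (cardsCs (~: S)) finset.setCK card_ord.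
  have -> : (N - #|S| == m)%N = (#|S| == N - m)%N.
    have : (#|S| <= N)%N by rewrite -[leqRHS]card_ord max_card.
    by move=> ?; apply/eqP/eqP; lia.
  by case: eqP; case: (S \subset _).
apply: (mulIf fN); rewrite mulrA divfK // -!natrM; congr (_%:R).
have [mB|Bm] := ltnP m #|B|.
  by rewrite (ffact_small mB) muln0 bin_small ?mul0n //; lia.
have h1 := bin_fact mN.
have h2 : ('C(N - #|B|, N - m) * ((N - m)`! * (m - #|B|)`!))%N = (N - #|B|)`!.
  rewrite -[in RHS](bin_fact (_ : (N - m <= N - #|B|)%N)); last lia.
  by congr (_ * (_ * _`!))%N; lia.
have h3 := ffact_fact Bm; have h4 := ffact_fact BN.
apply/eqP; rewrite -(eqn_pmul2r (fact_gt0 (N - m))) -(eqn_pmul2r (fact_gt0 (m - #|B|))).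
apply/eqP; transitivity (N`!); first by rewrite -h4 -h2; ring.
by rewrite -h1 -h3; ring.
Qed.

Lemma ffact_poly (R : idomainType) (r : nat) :
  exists2 f : {poly R}, (size f <= r.+1)%N &
    forall s : nat, (s ^_ r)%:R = f.[s%:R].
Proof.
exists (\prod_(i < r) ('X - i%:R%:P)).
  by rewrite size_prod_XsubC [X in (X <= _)%N]/= -[index_enum _]enumT size_enum_ord.
move=> s; rewrite horner_prod ffact_prod.
under [RHS]eq_bigr do rewrite hornerXsubC.
have [rs|sr] := leqP r s.
  by rewrite natr_prod; apply: eq_bigr => i _; rewrite natrB // ltnW // (leq_trans (ltn_ord i)).
(* For [s < r] truncated and ring subtraction may differ, but the factor of index [s] kills both
   products. *)
by rewrite (bigD1 (Ordinal sr)) //= subnn mul0n (bigD1 (Ordinal sr)) //= subrr mul0r.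
Qed.

(** * Polynomial functions of finitely many coordinates *)

(* A monomial is a coefficient together with the list of its variables, listed
   with multiplicity. *)
Definition polyform (R : realType) (I : Type) (d : nat) (F : (I -> R) -> R) : Prop :=
  exists2 us : seq (R * seq I), all (fun u => (size u.2 <= d)%N) us &
    forall c, F c = \sum_(u <- us) u.1 * \prod_(i <- u.2) c i.

Section Polyform.
Variables (R : realType) (I : Type).
Implicit Types (F G : (I -> R) -> R) (d : nat).

Lemma eq_polyform d F G : F =1 G -> polyform d F -> polyform d G.
Proof. by move=> FG [us usd usF]; exists us => // c; rewrite -FG. Qed.

Lemma polyform_le d d' F : (d <= d')%N -> polyform d F -> polyform d' F.
Proof.
move=> dd' [us usd usF]; exists us => //.
by apply: sub_all usd => u /leq_trans; exact.
Qed.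

Lemma polyform_cst d (a : R) : polyform d (fun _ : I -> R => a).
Proof.
by exists [:: (a, [::])] => // c; rewrite big_seq1 big_nil mulr1.
Qed.

Lemma polyformD d F G : polyform d F -> polyform d G ->
  polyform d (fun c => F c + G c).
Proof.
move=> [us usd usF] [vs vsd vsG]; exists (us ++ vs); first by rewrite all_cat usd.
by move=> c; rewrite big_cat /= usF vsG.
Qed.

Lemma polyformZ d (a : R) F : polyform d F -> polyform d (fun c => a * F c).
Proof.
move=> [us usd usF]; exists [seq (a * u.1, u.2) | u <- us]; first by rewrite all_map.
by move=> c; rewrite usF big_map mulr_sumr; apply: eq_bigr => u _; rewrite mulrA.
Qed.

Lemma polyform_sum d (J : Type) (r : seq J) (F : J -> (I -> R) -> R) :
  (forall j, polyform d (F j)) -> polyform d (fun c => \sum_(j <- r) F j c).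
Proof.
move=> pF; elim: r => [|j r IH].
  by apply: eq_polyform (polyform_cst d 0) => c; rewrite big_nil.
by apply: eq_polyform (polyformD (pF j) IH) => c; rewrite big_cons.
Qed.

Lemma polyformX d (i : I) F : polyform d F -> polyform d.+1 (fun c => c i * F c).
Proof.
move=> [us usd usF]; exists [seq (u.1, i :: u.2) | u <- us]; first by rewrite all_map.
move=> c; rewrite usF big_map mulr_sumr; apply: eq_bigr => u _ /=.
by rewrite big_cons mulrCA.
Qed.

End Polyform.

(** Each variable is replaced by a polynomial of degree at most one, so the degree bound is kept.
    This makes the increments of a polynomial, seen in fresh coordinates, polynomials with the same
    degree bound. *)
Lemma polyform_subst (R : realType) (I J : Type) (d : nat) (F : (I -> R) -> R)
    (x b : I -> R) (f : I -> J) : polyform d F ->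
  polyform d (fun z : J -> R => F (fun i => x i + b i * z (f i))).
Proof.
move=> [us usd usF].
have mono (u : seq I) :
    polyform (size u) (fun z : J -> R => \prod_(i <- u) (x i + b i * z (f i))).
  elim: u => [|i u IH].
    by apply: eq_polyform (polyform_cst _ _ 1) => c; rewrite big_nil.
  apply: eq_polyform (polyformD (polyform_le (leqnSn _) (polyformZ (x i) IH))
    (polyformZ (b i) (polyformX (f i) IH))) => c.
  by rewrite big_cons mulrDl !mulrA.
elim: us usd F usF => [|u us IH] /= => [_|/andP[ud usd]] F usF.
  by apply: eq_polyform (polyform_cst _ _ 0) => c; rewrite usF big_nil.
apply: eq_polyform (polyformD (polyform_le ud (polyformZ u.1 (mono u.2)))
  (IH usd _ (fun c => erefl _))) => c.
by rewrite usF big_cons.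
Qed.

Lemma sum_by_size (R : nzRingType) (I : Type) (d : nat) (us : seq (R * seq I))
    (w : R * seq I -> R) (t : R) :
  all (fun u => (size u.2 <= d)%N) us ->
  \sum_(u <- us) w u * t ^+ size u.2 =
  \sum_(k < d.+1) (\sum_(u <- us | size u.2 == k) w u) * t ^+ k.
Proof.
elim: us => [_|u us IH /= /andP[ud usd]].
  by rewrite big_nil big1 // => k _; rewrite big_nil mul0r.
rewrite big_cons IH //.
under [RHS]eq_bigr => k _ do rewrite big_cons.
rewrite [RHS](bigD1 (Ordinal (ud : (_ < d.+1)%N))) //= eqxx mulrDl -addrA; congr (_ + _).
rewrite (bigD1 (Ordinal (ud : (_ < d.+1)%N))) //=; congr (_ + _).
apply: eq_bigr => k kn; case: eqP => // e.
by case/eqP: kn; apply: val_inj.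
Qed.

(* [F c] is the sum of the coefficients of the polynomial [s |-> F (s * c)],
   and these are controlled by its values near [0]. *)
Lemma polyform_bounded (R : realType) (d : nat) (B : R) (t : R) : 0 < t ->
  exists2 C : R, 0 <= C & forall (I : Type) (F : (I -> R) -> R) (c : I -> R),
    polyform d F ->
    (forall s : R, 0 <= s <= t -> `|F (fun i => s * c i)| <= B) -> `|F c| <= C.
Proof.
move=> t0; have [C C0 HC] := coef_bound R d.
(* With this spacing all nodes [i * t'], [i <= d.+1], lie in [[0, t]], where [F] is controlled on
   the ray through [c]. *)
pose t' := t / d.+1%:R; have t'0 : 0 < t' by rewrite divr_gt0 ?ltr0n.
exists (\sum_(k < d.+1) C * `|B| / t' ^+ k).
  apply: sumr_ge0 => k _.
  by rewrite divr_ge0 ?mulr_ge0 ?exprn_ge0 // ltW.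
move=> I F c [us usd usF] FB.
pose a k := \sum_(u <- us | size u.2 == k) u.1 * \prod_(i <- u.2) c i.
have FE s : F (fun i => s * c i) = \sum_(k < d.+1) a k * s ^+ k.
  rewrite /a -sum_by_size // usF; apply: eq_bigr => u _.
  rewrite big_split /= -mulrA; congr (_ * _).
  by rewrite mulrC big_const_seq count_predT iter_mulr_1.
have -> : F c = \sum_(k < d.+1) a k.
  have := FE 1; rewrite (_ : (fun i => 1 * c i) = c).
    by move=> ->; apply: eq_bigr => k _; rewrite expr1n mulr1.
  by apply/funext => i; rewrite mul1r.
apply: le_trans (ler_norm_sum _ _ _) _; apply: ler_sum => k _.
rewrite ler_pdivlMr ?exprn_gt0 //; apply: HC => //; last by rewrite -ltnS.
move=> i /andP[i0 id]; rewrite -FE; apply: le_trans (FB _ _) (ler_norm _).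
rewrite mulr_ge0 ?ler0n ?(ltW t'0) //= /t' mulrA mulrAC ler_piMl ?(ltW t0) //.
by rewrite ler_pdivrMr ?ltr0n // mul1r ler_nat.
Qed.

(** * Means over rectangles *)

Lemma sum_ffact_poly (R : idomainType) (I : Type) (us : seq I) (P : pred I)
    (c : I -> R) (r : I -> nat) (d : nat) :
  (forall v, P v -> (r v <= d)%N) ->
  exists g : nat -> R, forall s : nat,
    \sum_(v <- us | P v) c v * (s ^_ (r v))%:R = \sum_(k < d.+1) g k * s%:R ^+ k.
Proof.
move=> rd.
suff [f fd fE] : exists2 f : {poly R}, (size f <= d.+1)%N &
    forall s : nat, \sum_(v <- us | P v) c v * (s ^_ (r v))%:R = f.[s%:R].
  by exists (fun k => f`_k) => s; rewrite fE (horner_coef_wide _ fd).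
elim: us => [|v us [f fd fE]].
  by exists 0; rewrite ?size_poly0 // => s; rewrite big_nil horner0.
case: (boolP (P v)) => Pv; last first.
  by exists f => // s; rewrite big_cons (negbTE Pv).
have [h hd hE] := ffact_poly R (r v).
exists (c v *: h + f).
  rewrite (leq_trans (size_polyD _ _)) // geq_max fd andbT.
  by rewrite (leq_trans (size_scale_leq _ _)) // (leq_trans hd) // ltnS rd.
by move=> s; rewrite big_cons Pv fE hE hornerD hornerZ.
Qed.

(** It is enough that [e * x k >= 2] for each of the finitely many [k] with [x k > 0]. The sum of
    the truncated quotients, plus one, dominates each such [2 / x k], whatever [K] is. *)
Lemma exists_exponent (R : realType) (d : nat) (x : nat -> R) :
  exists2 e : nat, (0 < e)%N & forall K k : nat, (0 < K)%N -> (k <= d)%N ->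
    0 < x k -> (K ^ e)%N%:R `^ (- x k) <= (K%:R ^+ 2)^-1.
Proof.
exists (\sum_(k < d.+1) Num.truncn (2 / x k)).+1 => // K k K0 kd xk.
rewrite powRN lef_pV2 ?posrE ?powR_gt0 ?exprn_gt0 ?ltr0n ?expn_gt0 ?K0 //.
rewrite natrX -!powR_mulrn ?ler0n // -powRrM ler_powR ?ler1n //.
rewrite -ler_pdivrMr // (le_trans (ltW (truncnS_gt _))) // ler_nat ltnS.
by rewrite (bigD1 (Ordinal (kd : (k < d.+1)%N))) //= leq_addr.
Qed.

(** The [rho]-th power of the norm of the [ell_rho]-sum of [N] copies of [ell_q^L]. *)
Definition rowmass (R : realType) (rho q : R) (N L : nat) (z : 'I_N * 'I_L -> R) : R :=
  \sum_(b < N) (\sum_(l < L) `|z (b, l)| `^ q) `^ (rho / q).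

Definition box (R : realType) (N L : nat) (S : {set 'I_N}) (T : {set 'I_L}) (t : R)
  : 'I_N * 'I_L -> R := fun j => t * ((j.1 \in S) && (j.2 \in T))%:R.

Lemma rowmass_box (R : realType) (rho q : R) (N L : nat) (S : {set 'I_N})
    (T : {set 'I_L}) (t : R) : 0 < rho -> 0 < q ->
  rowmass rho q (box S T t) = #|S|%:R * (#|T|%:R * `|t| `^ q) `^ (rho / q).
Proof.
move=> rho0 q0; have rq0 : rho / q != 0 by rewrite gt_eqF // divr_gt0.
rewrite /rowmass (bigID (mem S)) /= [X in _ + X]big1 ?addr0 => [|b bS]; last first.
  rewrite big1 ?powR0 // => l _.
  by rewrite /box /= (negbTE bS) mulr0 normr0 powR0 ?gt_eqF.
under eq_bigr => b bS.
  rewrite (bigID (mem T)) /= [X in _ + X]big1 ?addr0 => [|l lT]; last first.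
    by rewrite /box /= (negbTE lT) andbF mulr0 normr0 powR0 ?gt_eqF.
  under eq_bigr => l lT do rewrite /box /= bS lT mulr1.
  rewrite sumr_const -[_ *+ _]mulr_natl.
  over.
by rewrite sumr_const -[LHS]mulr_natl.
Qed.

Section MeanOverBoxes.
Variables (R : realType) (N L : nat) (us : seq (R * seq ('I_N * 'I_L))).

(** The numbers of distinct rows and of distinct columns met by a monomial: only these two index
    sets decide whether it survives on a box. *)
Let rk1 (v : R * seq ('I_N * 'I_L)) := #|[set j.1 | j in v.2]|.
Let rk2 (v : R * seq ('I_N * 'I_L)) := #|[set j.2 | j in v.2]|.

(* The coefficient of [t ^ k] in the mean of [F (+- t * 1_(S x T))] over the
   sign and over all [S], [T] with [#|S| = s] and [#|T| = u]; it is polynomial in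
   [s] and in [u], as a set of size [r] lies in [S] with probability
   [s ^_ r / N ^_ r]. *)
Definition mean_coef (k s u : nat) : R :=
  (~~ odd k)%:R * \sum_(v <- us | size v.2 == k)
    v.1 * ((s ^_ (rk1 v))%:R / (N ^_ (rk1 v))%:R)
        * ((u ^_ (rk2 v))%:R / (L ^_ (rk2 v))%:R).

(** On a box a monomial equals a power of the height times the indicators that [S] contains its rows
    and [T] its columns. The two indicators are summed separately, and the sign cancels the odd
    sizes. *)
Lemma sum_box (d : nat) (F : ('I_N * 'I_L -> R) -> R) (s u : nat) (t : R) :
  all (fun v => (size v.2 <= d)%N) us ->
  (forall c, F c = \sum_(v <- us) v.1 * \prod_(i <- v.2) c i) ->
  (s <= N)%N -> (u <= L)%N ->
  \sum_(S : {set 'I_N} | #|S| == s) \sum_(T : {set 'I_L} | #|T| == u)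
     (F (box S T t) + F (box S T (- t))) =
  'C(N, s)%:R * 'C(L, u)%:R * ((\sum_(k < d.+1) mean_coef k s u * t ^+ k) *+ 2).
Proof.
move=> usd usF sN uL.
have prodE S T (v : R * seq ('I_N * 'I_L)) t' : \prod_(j <- v.2) box S T t' j =
    t' ^+ size v.2 * (([set j.1 | j in v.2] \subset S)%:R
                    * ([set j.2 | j in v.2] \subset T)%:R).
  rewrite /box big_split /= big_const_seq count_predT iter_mulr_1; congr (_ * _).
  rewrite -natrM mulnb.
  have -> : ([set j.1 | j in v.2] \subset S) && ([set j.2 | j in v.2] \subset T) =
      all (fun j => (j.1 \in S) && (j.2 \in T)) v.2.
    apply/andP/allP => [[/fintype.subsetP h1 /fintype.subsetP h2] j jv|h].
      by rewrite h1 ?h2 // imset_f.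
    by split; apply/fintype.subsetP => _ /imsetP[j jv ->]; case/andP: (h j jv).
  elim: v.2 => [|j v' IH]; first by rewrite big_nil.
  by rewrite big_cons IH /= -natrM mulnb.
have FE S T : F (box S T t) + F (box S T (- t)) =
   \sum_(v <- us) ((~~ odd (size v.2))%:R * v.1 * t ^+ size v.2) *+ 2 *
     (([set j.1 | j in v.2] \subset S)%:R * ([set j.2 | j in v.2] \subset T)%:R).
  rewrite !usF -big_split /=; apply: eq_bigr => v _.
  rewrite !prodE exprNn -signr_odd; case: odd => /=; rewrite ?expr1 ?expr0; ring.
under eq_bigr => S _ do under eq_bigr => T _ do rewrite FE.
under eq_bigr => S _ do rewrite exchange_big /=.
rewrite exchange_big /= mulrnAr -mulr_natr.
transitivity (\sum_(v <- us) ((~~ odd (size v.2))%:R * v.1 * t ^+ size v.2) *+ 2 *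
   (('C(N, s)%:R * ((s ^_ (rk1 v))%:R / (N ^_ (rk1 v))%:R)) *
    ('C(L, u)%:R * ((u ^_ (rk2 v))%:R / (L ^_ (rk2 v))%:R)))).
  apply: eq_bigr => v _; rewrite -!sum_subset_draws // big_distrl /= mulr_sumr.
  by apply: eq_bigr => S _; rewrite !mulr_sumr.
transitivity ('C(N, s)%:R * 'C(L, u)%:R * (\sum_(v <- us)
   ((~~ odd (size v.2))%:R * v.1 * ((s ^_ (rk1 v))%:R / (N ^_ (rk1 v))%:R)
        * ((u ^_ (rk2 v))%:R / (L ^_ (rk2 v))%:R)) * t ^+ size v.2) * 2%:R).
  rewrite mulr_sumr mulr_suml; apply: eq_bigr => v _; rewrite -mulr_natr; ring.
rewrite (sum_by_size _ _ usd); congr (_ * _ * _); apply: eq_bigr => k _; congr (_ * _).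
rewrite /mean_coef mulr_sumr; apply: eq_bigr => v /eqP ->; ring.
Qed.

Lemma rk1_le v : (rk1 v <= size v.2)%N.
Proof. exact: leq_trans (leq_imset_card _ _) (card_size _). Qed.

Lemma rk2_le v : (rk2 v <= size v.2)%N.
Proof. exact: leq_trans (leq_imset_card _ _) (card_size _). Qed.

(** The degree in [s] is at most the number of distinct rows met, hence at most [k]. *)
Lemma mean_coef_poly1 (d k u : nat) : (k <= d)%N -> exists g : nat -> R,
  forall s, mean_coef k s u = \sum_(r < d.+1) g r * s%:R ^+ r.
Proof.
move=> kd; pose c (v : R * seq ('I_N * 'I_L)) := (~~ odd k)%:R * v.1 / (N ^_ (rk1 v))%:R
  * ((u ^_ (rk2 v))%:R / (L ^_ (rk2 v))%:R).
have [|g gE] := @sum_ffact_poly R _ us (fun v => size v.2 == k) c rk1 d.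
  by move=> v /eqP vk; rewrite (leq_trans (rk1_le v)) // vk.
exists g => s; rewrite -gE /mean_coef mulr_sumr; apply: eq_bigr => v _; rewrite /c; ring.
Qed.

Lemma mean_coef_poly2 (d k s : nat) : (k <= d)%N -> exists g : nat -> R,
  forall u, mean_coef k s u = \sum_(r < d.+1) g r * u%:R ^+ r.
Proof.
move=> kd; pose c (v : R * seq ('I_N * 'I_L)) := (~~ odd k)%:R * v.1 / (L ^_ (rk2 v))%:R
  * ((s ^_ (rk1 v))%:R / (N ^_ (rk1 v))%:R).
have [|g gE] := @sum_ffact_poly R _ us (fun v => size v.2 == k) c rk2 d.
  by move=> v /eqP vk; rewrite (leq_trans (rk2_le v)) // vk.
exists g => u; rewrite -gE /mean_coef mulr_sumr; apply: eq_bigr => v _; rewrite /c; ring.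
Qed.

(** A nonconstant monomial meets at least one row, so it vanishes on a box without rows; this
    removes the constant coefficient in the number of rows. *)
Lemma mean_coef0 (k u : nat) : (0 < k)%N -> mean_coef k 0 u = 0.
Proof.
move=> k0; rewrite /mean_coef big1 ?mulr0 // => v /eqP vk.
have : (0 < rk1 v)%N.
  case: v vk => a [|j v] /= vk; first by rewrite -vk in k0.
  by apply/card_gt0P; exists j.1; apply/imset_f; rewrite inE eqxx.
by case: (rk1 v) => // r _; rewrite ffact0n mul0r mulr0 mul0r.
Qed.

Lemma mean_coef_const (s u : nat) (F : ('I_N * 'I_L -> R) -> R) :
  (forall c, F c = \sum_(v <- us) v.1 * \prod_(i <- v.2) c i) ->
  mean_coef 0 s u = F (fun _ => 0).
Proof.
move=> usF; rewrite /mean_coef mul1r usF big_mkcond /=; apply: eq_bigr => -[a [|j v]] _ /=.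
  rewrite /rk1 /rk2 /= big_nil.
  have e1 : [set j.1 | j in [::] : seq ('I_N * 'I_L)] = finset.set0.
    by apply/setP => x; rewrite inE; apply/imsetP => -[].
  have e2 : [set j.2 | j in [::] : seq ('I_N * 'I_L)] = finset.set0.
    by apply/setP => x; rewrite inE; apply/imsetP => -[].
  by rewrite e1 e2 !cards0 !ffactn0 divr1 !mulr1.
by rewrite big_cons mul0r mulr0.
Qed.

End MeanOverBoxes.

Lemma powR_le (R : realType) (r x y : R) :
  0 <= r -> 0 <= x -> x <= y -> x `^ r <= y `^ r.
Proof.
by move=> r0 x0 xy; apply: ge0_ler_powR; rewrite // nnegrE // (le_trans x0).
Qed.

Lemma sum_draws_cst (R : numDomainType) (N s : nat) (x : R) :
  \sum_(S : {set 'I_N} | #|S| == s) x = 'C(N, s)%:R * x.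
Proof. by rewrite sumr_const -[LHS]mulr_natl -cardsE card_draws card_ord. Qed.

(** The height [s ^ (-1/rho) * u ^ (-1/q)] gives a rectangle with [s] rows and [u] columns mass one,
    each row weighing [1/s]. *)
Lemma mass_scale (R : realType) (rho q s u : R) :
  0 < rho -> 0 < q -> 0 < s -> 0 < u ->
  (u * (s `^ (- rho^-1) * u `^ (- q^-1)) `^ q) `^ (rho / q) = s^-1.
Proof.
move=> rho0 q0 s0 u0.
rewrite (@powRM _ (s `^ _)) ?powR_ge0 // -(@powRrM _ u) mulNr mulVf ?gt_eqF //.
rewrite powR_inv1 ?(ltW u0) // mulrC divfK ?gt_eqF // -!powRrM -[RHS]powR_inv1 ?(ltW s0) //.
by congr (_ `^ _); field; rewrite !gt_eqF.
Qed.

(** Means over rectangles of mass at most one are bounded by [C]. Reading off the coefficient of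
    degree [k] in the height, up to the height [T] of mass one, costs [T ^ (-k)], which is the
    growth in [s] and [u]; [C1] depends on [d] only. *)
Lemma mean_coef_le (R : realType) (d : nat) : exists2 C1 : R, 0 <= C1 &
  forall (rho q : R) (N L : nat) (us : seq (R * seq ('I_N * 'I_L)))
    (F : ('I_N * 'I_L -> R) -> R) (C : R), 0 < rho -> 0 < q ->
  all (fun v => (size v.2 <= d)%N) us ->
  (forall c, F c = \sum_(v <- us) v.1 * \prod_(i <- v.2) c i) ->
  (forall z, rowmass rho q z <= 1 -> `|F z| <= C) ->
  forall s u k : nat, (0 < s <= N)%N -> (0 < u <= L)%N -> (k <= d)%N ->
    `|mean_coef us k s u| <= C1 * C * s%:R `^ (k%:R / rho) * u%:R `^ (k%:R / q).
Proof.
have [Ct Ct0 HCt] := coef_bound R d.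
(* The nodes are multiples of [T / d.+1], hence a factor [d.+1 ^ k <= d.+1 ^ d]. *)
exists (Ct * d.+1%:R ^+ d); first by rewrite mulr_ge0 ?exprn_ge0.
move=> rho q N L us F C rho0 q0 usd usF FC s u k /andP[s0 sN] /andP[u0 uL] kd.
have s0' : 0 < s%:R :> R by rewrite ltr0n.
have u0' : 0 < u%:R :> R by rewrite ltr0n.
pose T : R := s%:R `^ (- rho^-1) * u%:R `^ (- q^-1).
have T0 : 0 < T by rewrite mulr_gt0 ?powR_gt0.
have := HCt (fun k => mean_coef us k s u) C (T / d.+1%:R).
rewrite divr_gt0 ?ltr0n // => /(_ isT) /(_ _ k kd) H.
have Tk : (T / d.+1%:R) ^+ k =
    (d.+1%:R ^+ k * s%:R `^ (k%:R / rho) * u%:R `^ (k%:R / q))^-1.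
  rewrite expr_div_n /T exprMn -!powR_mulrn ?powR_ge0 // -!powRrM !mulNr.
  by rewrite ![_^-1 * k%:R]mulrC !powRN -!invfM; congr (_^-1); ring.
have {}H : `|mean_coef us k s u| <=
    Ct * C * (d.+1%:R ^+ k * s%:R `^ (k%:R / rho) * u%:R `^ (k%:R / q)).
  rewrite -ler_pdivrMr; last by rewrite !mulr_gt0 ?exprn_gt0 ?powR_gt0.
  rewrite -Tk; apply: H => i /andP[i0 id].
  set t := i%:R * _; have t0 : 0 <= t by rewrite !mulr_ge0 ?invr_ge0 ?ler0n // ltW.
  have tT : t <= T.
    rewrite /t mulrCA ler_piMr ?(ltW T0) // ler_pdivrMr ?ltr0n // mul1r ler_nat //.
  have boxle (S : {set 'I_N}) (S' : {set 'I_L}) t' :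
      #|S| = s -> #|S'| = u -> `|t'| = t -> rowmass rho q (box S S' t') <= 1.
    move=> Ss S'u t't; rewrite rowmass_box // Ss S'u t't.
    rewrite -[leRHS](mulfV (lt0r_neq0 s0')) -(mass_scale rho0 q0 s0' u0') -/T.
    apply: ler_wpM2l; first exact: ltW.
    apply: powR_le; rewrite ?divr_ge0 ?mulr_ge0 ?powR_ge0 ?(ltW rho0) ?(ltW q0) //.
    by apply: ler_wpM2l => //; apply: powR_le => //; exact: ltW.
  have CC0 : 0 < 'C(N, s)%:R * 'C(L, u)%:R :> R.
    by rewrite -natrM ltr0n muln_gt0 !bin_gt0 sN uL.
  have := congr1 Num.norm (sum_box t usd usF sN uL).
  rewrite normrM (gtr0_norm CC0) normrMn => SE.
  rewrite -(ler_pM2l CC0) -(ler_pMn2r (isT : (0 < 2)%N)) -mulrnAr -SE.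
  rewrite (le_trans (ler_norm_sum _ _ _)) // -mulrA -mulrnAr -sum_draws_cst ler_sum // => S /eqP Ss.
  rewrite (le_trans (ler_norm_sum _ _ _)) // -mulrnAr -sum_draws_cst ler_sum // => S' /eqP S'u.
  rewrite (le_trans (ler_normD _ _)) // mulr2n lerD // FC // boxle //.
    by rewrite ger0_norm.
  by rewrite normrN ger0_norm.
apply: le_trans H _.
have C0 : 0 <= C by apply: le_trans (FC (fun _ => 0) _) => //; rewrite /rowmass big1 // => b _;
  rewrite big1 ?powR0 ?gt_eqF ?divr_gt0 // => l _; rewrite normr0 powR0 ?gt_eqF.
rewrite -!mulrA ler_wpM2l // [leRHS]mulrCA ler_wpM2l // ler_wpM2r ?mulr_ge0 ?powR_ge0 //.
by rewrite ler_weXn2l // ler1n.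
Qed.

(* Take [z] among the [+- t * 1_(S x T)] with [#|S| = m = K ^ (e - 1)] and
   [#|T| = M = K ^ e']. The degree-[k] term of the mean is
   [\sum_r g r * m ^ r * t ^ k] with [g 0 = 0]. If [k != rho], its terms are
   [O(K ^ -2)]: the factor [K ^ - r] does it for [r >= 2], the growth bound for
   [r = 1]. If [k = rho], it vanishes for odd [k] by symmetry, and is small for even
   [k] by the growth bound in [#|T|], as [rho / q] is not an integer. *)
Lemma one_step (R : realType) (d : nat) (rho q : R) : 0 < rho -> 0 < q ->
  (forall k r : nat, ~~ odd k -> k%:R = rho -> r%:R != rho / q) ->
  exists2 C0 : R, 0 <= C0 & forall K : nat, (0 < K)%N -> exists N L : nat,
  forall (F : ('I_N * 'I_L -> R) -> R) (C : R), polyform d F ->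
    (forall z, rowmass rho q z <= 1 -> `|F z| <= C) ->
    exists2 z, rowmass rho q z = K%:R^-1 &
      F z <= F (fun _ => 0) + C0 * C / K%:R ^+ 2.
Proof.
move=> rho0 q0 hres.
have [C1 C10 HC1] := mean_coef_le R d.
have /choice[Cg HCg] : forall k : nat, exists Ck : R, 0 <= Ck /\
    forall (g : nat -> R) (B : R) (delta : nat), (0 < delta)%N ->
    (forall i : nat, (0 < i <= d.+1 * delta ^ 2)%N ->
       `|\sum_(r < d.+1) g r * i%:R ^+ r| <= B * i%:R `^ (k%:R / rho)) ->
    forall r, (r <= d)%N -> `|g r| * delta%:R `^ (r%:R - k%:R / rho)
      <= Ck * B * delta%:R `^ (- `|r%:R - k%:R / rho|).
  move=> k; have [|Ck Ck0 HCk] := @growth_coef_bound R d (k%:R / rho).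
    by rewrite divr_ge0 ?ler0n // ltW.
  by exists Ck.
have [|Cq Cq0 HCq] := @growth_coef_bound R d (rho / q).
  by rewrite divr_ge0 ?ltW.
(* [e] serves the part linear in the number of rows, [e'] the powers of the number of columns in
   degree [rho]. *)
have [e e0 He] := exists_exponent d (fun k => `|1%:R - k%:R / rho| : R).
have [e' e'0 He'] := exists_exponent d (fun r => `|r%:R - rho / q| : R).
pose E := d.+1%:R * (\sum_(k < d.+1) Cg k + Cq) * C1.
have Cg0 k : 0 <= Cg k by have [] := HCg k.
have SCg0 : 0 <= \sum_(k < d.+1) Cg k by apply: sumr_ge0.
have E0 : 0 <= E by rewrite !mulr_ge0 // addr_ge0.
exists (d.+1%:R * E); first by rewrite mulr_ge0.
move=> K K0; have K0' : 0 < K%:R :> R by rewrite ltr0n.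
have K1 : 1 <= K%:R :> R by rewrite ler1n.
(* At the height [t] below, [delta] rows of [M] entries have mass one, so [m = delta / K] rows have
   mass [1/K]. *)
pose m := (K ^ e.-1)%N; pose delta := (K ^ e)%N; pose M := (K ^ e')%N.
have deltaE : delta = (K * m)%N by rewrite /m -expnS prednK.
have m0 : (0 < m)%N by rewrite expn_gt0 K0.
have delta0 : (0 < delta)%N by rewrite expn_gt0 K0.
have M0 : (0 < M)%N by rewrite expn_gt0 K0.
(* These dimensions leave the range of sampling that the growth bounds at the scales [delta] and [M]
   require. *)
exists (d.+1 * delta ^ 2)%N, (d.+1 * M ^ 2)%N => F C [us usd usF] FC.
set N := (d.+1 * delta ^ 2)%N; set L := (d.+1 * M ^ 2)%N.
have mN : (m <= N)%N.
  rewrite /N deltaE; nia.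
have ML : (M <= L)%N by rewrite /L; nia.
have bnd := HC1 rho q _ _ us F C rho0 q0 usd usF FC.
have C0 : 0 <= C by apply: le_trans (FC (fun _ => 0) _) => //; rewrite /rowmass big1 // => b _;
  rewrite big1 ?powR0 ?gt_eqF ?divr_gt0 // => l _; rewrite normr0 powR0 ?gt_eqF.
have m0' : 0 < m%:R :> R by rewrite ltr0n.
have delta0' : 0 < delta%:R :> R by rewrite ltr0n.
have M0' : 0 < M%:R :> R by rewrite ltr0n.
have delta1 : 1 <= delta%:R :> R by rewrite ler1n.
have deltaR : delta%:R = K%:R * m%:R :> R by rewrite deltaE natrM.
pose t : R := delta%:R `^ (- rho^-1) * M%:R `^ (- q^-1).
have t0 : 0 < t by rewrite mulr_gt0 ?powR_gt0.
have tk k : t ^+ k = delta%:R `^ (- (k%:R / rho)) * M%:R `^ (- (k%:R / q)).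
  by rewrite exprMn -!powR_mulrn ?powR_ge0 // -!powRrM !mulNr ![_^-1 * _]mulrC.
have term k : (0 < k <= d)%N -> `|mean_coef us k m M * t ^+ k| <= E * C / K%:R ^+ 2.
  move=> /andP[k0 kd].
  have [kr|kr] := eqVneq (k%:R : R) rho; last first.
  - have [g gE] := mean_coef_poly1 us M kd.
    pose B := C1 * C * M%:R `^ (k%:R / q).
    have B0 : 0 <= B by rewrite !mulr_ge0 ?powR_ge0.
    have gB : forall i : nat, (0 < i <= d.+1 * delta ^ 2)%N ->
       `|\sum_(r < d.+1) g r * i%:R ^+ r| <= B * i%:R `^ (k%:R / rho).
      by move=> i iN; rewrite -gE /B mulrAC; apply: bnd; rewrite // M0.
    have g0 : g 0%N = 0.
      have := gE 0%N; rewrite mean_coef0 // big_ord_recl expr0 mulr1 big1 ?addr0 //.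
      by move=> i _; rewrite expr0n mulr0.
    have gr r : (r <= d)%N ->
        `|g r * m%:R ^+ r| * delta%:R `^ (- (k%:R / rho)) <= Cg k * B / K%:R ^+ 2.
      move=> rd; have [_ /(_ g B delta delta0 gB r rd) H] := HCg k.
      (* Writing [m = delta / K] splits off the gain [K ^ (-r)]. *)
      have -> : `|g r * m%:R ^+ r| * delta%:R `^ (- (k%:R / rho)) =
          `|g r| * delta%:R `^ (r%:R - k%:R / rho) / K%:R ^+ r.
        rewrite powRD ?(gt_eqF delta0') ?implybT // powR_mulrn ?ler0n //.
        rewrite normrM [`|m%:R ^+ r|]ger0_norm ?exprn_ge0 // deltaR exprMn.
        by field; rewrite expf_neq0 ?gt_eqF.
      case: r rd H => [|r] rd H; first by rewrite g0 normr0 !mul0r !mulr_ge0 ?invr_ge0 ?exprn_ge0.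
      apply: le_trans (ler_wpM2r _ H) _; first by rewrite invr_ge0 exprn_ge0.
      rewrite -[leLHS]mulrA ler_wpM2l ?mulr_ge0 //.
      case: r rd {H} => [|r] rd.
        rewrite expr1 -[leRHS]mulr1 ler_pM ?powR_ge0 ?invr_ge0 ?ler0n //; last first.
          by rewrite invf_le1.
        apply: He => //; rewrite normr_gt0 subr_eq0 eq_sym.
        by apply: contra_neq kr => h; rewrite -[LHS](divfK (lt0r_neq0 rho0)) h mul1r.
      rewrite -[leRHS]mul1r ler_pM ?powR_ge0 ?invr_ge0 ?exprn_ge0 ?ler0n //.
        rewrite powRN invf_le1 ?powR_gt0 //.
        by rewrite -[leLHS](powRr0 (delta%:R : R)) ler_powR.
      by rewrite lef_pV2 ?posrE ?exprn_gt0 // ler_weXn2l.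
    rewrite gE tk mulrA normrM [`|M%:R `^ _|]ger0_norm ?powR_ge0 //.
    rewrite (powRN M%:R) ler_pdivrMr ?powR_gt0 // normrM [`|delta%:R `^ _|]ger0_norm ?powR_ge0 //.
    apply: le_trans (ler_wpM2r (powR_ge0 _ _) (ler_norm_sum _ _ _)) _.
    rewrite mulr_suml.
    apply: (@le_trans _ _ (\sum_(r < d.+1) Cg k * B / K%:R ^+ 2)).
      by apply: ler_sum => r _; apply: gr; rewrite -ltnS.
    rewrite sumr_const card_ord -[leLHS]mulr_natl /E /B.
    have -> : d.+1%:R * (\sum_(k0 < d.+1) Cg k0 + Cq) * C1 * C / K%:R ^+ 2 * M%:R `^ (k%:R / q) =
      d.+1%:R * ((\sum_(k0 < d.+1) Cg k0 + Cq) * (C1 * C * M%:R `^ (k%:R / q)) / K%:R ^+ 2).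
      by ring.
    rewrite ler_wpM2l // ler_wpM2r ?invr_ge0 ?exprn_ge0 ?ler0n // ler_wpM2r //.
    rewrite (bigD1 (Ordinal (kd : (k < d.+1)%N))) //= -addrA lerDl addr_ge0 //.
    by apply: sumr_ge0.
  - case: (boolP (odd k)) => ko.
      by rewrite /mean_coef ko !mul0r normr0 divr_ge0 ?(mulr_ge0 E0 C0) ?exprn_ge0.
    have [g gE] := mean_coef_poly2 us m kd.
    (* In degree [rho] the bound is linear in the number of rows, so the gain has to come from the
       number of columns. *)
    pose B := C1 * C * m%:R.
    have B0 : 0 <= B by rewrite !mulr_ge0.
    have gB : forall i : nat, (0 < i <= d.+1 * M ^ 2)%N ->
       `|\sum_(r < d.+1) g r * i%:R ^+ r| <= B * i%:R `^ (rho / q).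
      move=> i iN; rewrite -gE /B.
      have -> : m%:R = m%:R `^ (k%:R / rho) :> R by rewrite kr divff ?gt_eqF // powRr1.
      by rewrite -{2}kr; apply: bnd; rewrite // m0.
    have gr r : (r <= d)%N ->
        `|g r * M%:R ^+ r| * M%:R `^ (- (rho / q)) <= Cq * B / K%:R ^+ 2.
      move=> rd; have H := HCq g B M M0 gB r rd.
      have -> : `|g r * M%:R ^+ r| * M%:R `^ (- (rho / q)) =
          `|g r| * M%:R `^ (r%:R - rho / q).
        rewrite powRD ?(gt_eqF M0') ?implybT // powR_mulrn ?ler0n //.
        by rewrite normrM [`|M%:R ^+ r|]ger0_norm ?exprn_ge0 // mulrA.
      apply: le_trans H _; rewrite ler_wpM2l ?mulr_ge0 //.
      by apply: He' => //; rewrite normr_gt0 subr_eq0; apply: hres ko kr.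
    rewrite gE tk kr divff ?gt_eqF // powR_inv1 ?ler0n // mulrCA normrM.
    rewrite [`|_^-1|]ger0_norm ?invr_ge0 ?ler0n // mulrC ler_pdivrMr //.
    rewrite normrM [`|M%:R `^ _|]ger0_norm ?powR_ge0 //.
    apply: le_trans (ler_wpM2r (powR_ge0 _ _) (ler_norm_sum _ _ _)) _.
    rewrite mulr_suml.
    apply: (@le_trans _ _ (\sum_(r < d.+1) Cq * B / K%:R ^+ 2)).
      by apply: ler_sum => r _; apply: gr; rewrite -ltnS.
    rewrite sumr_const card_ord -[leLHS]mulr_natl /E /B.
    have -> : d.+1%:R * (\sum_(k0 < d.+1) Cg k0 + Cq) * C1 * C / K%:R ^+ 2 * delta%:R =
      d.+1%:R * ((\sum_(k0 < d.+1) Cg k0 + Cq) * (C1 * C * delta%:R) / K%:R ^+ 2).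
      by ring.
    rewrite ler_wpM2l // ler_wpM2r ?invr_ge0 ?exprn_ge0 ?ler0n //.
    rewrite ler_pM // ?lerDr // ler_wpM2l ?mulr_ge0 // deltaR ler_peMl //.
pose b := F (fun _ => 0) + d.+1%:R * E * C / K%:R ^+ 2.
have mean : \sum_(k < d.+1) mean_coef us k m M * t ^+ k <= b.
  rewrite big_ord_recl expr0 mulr1 (mean_coef_const _ _ usF) lerD2l.
  apply: (@le_trans _ _ (\sum_(k < d) E * C / K%:R ^+ 2)).
    apply: ler_sum => k _; apply: le_trans (ler_norm _) (term _ _).
    by rewrite /= /bump add1n ltn_ord.
  have -> : d.+1%:R * E * C / K%:R ^+ 2 = d.+1%:R * (E * C / K%:R ^+ 2) by ring.
  rewrite sumr_const card_ord -[leLHS]mulr_natl ler_wpM2r ?ler_nat //.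
  by rewrite divr_ge0 ?(mulr_ge0 E0 C0) ?exprn_ge0.
have boxmass (S : {set 'I_N}) (T : {set 'I_L}) t' :
    #|S| = m -> #|T| = M -> `|t'| = t -> rowmass rho q (box S T t') = K%:R^-1.
  move=> Sm TM t't; rewrite rowmass_box // Sm TM t't /t.
  rewrite mass_scale // deltaR.
  by rewrite invfM mulrCA mulfV ?gt_eqF // mulr1.
have CN0 : 0 < 'C(N, m)%:R :> R by rewrite ltr0n bin_gt0.
have CL0 : 0 < 'C(L, M)%:R :> R by rewrite ltr0n bin_gt0.
have : \sum_(S : {set 'I_N} | #|S| == m) \sum_(T : {set 'I_L} | #|T| == M)
    (F (box S T t) + F (box S T (- t))) <=
    \sum_(S : {set 'I_N} | #|S| == m) \sum_(T : {set 'I_L} | #|T| == M) b *+ 2.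
  rewrite (sum_box t usd usF mN ML) !sum_draws_cst mulrA.
  rewrite ler_wpM2l ?(mulr_ge0 (ltW CN0) (ltW CL0)) //.
  by rewrite lerMn2r mean.
(* If no box qualified, every value at [t] and at [- t] would exceed [b], and so would their
   mean. *)
move=> H; apply: contrapT => none.
have gtb (S : {set 'I_N}) (T : {set 'I_L}) t' : #|S| = m -> #|T| = M -> `|t'| = t -> b < F (box S T t').
  move=> Sm TM t't; rewrite ltNge; apply/negP => Fb; apply: none.
  by exists (box S T t'); [exact: boxmass|exact: Fb].
move: H; rewrite leNgt => /negP; apply.
have draw n k : (k <= n)%N -> exists S : {set 'I_n}, #|S| == k.
  move=> kn; have : (0 < #|[set A : {set 'I_n} | #|A| == k]|)%N.
    by rewrite card_draws card_ord bin_gt0.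
  by case/card_gt0P => S; rewrite inE; exists S.
apply: ltr_sum => [|S /eqP Sm].
  by have [S Sm] := draw _ _ mN; apply/hasP; exists S; rewrite ?mem_index_enum.
apply: ltr_sum => [|T /eqP TM].
  by have [T TM] := draw _ _ ML; apply/hasP; exists T; rewrite ?mem_index_enum.
by rewrite mulr2n ltrD // gtb // ?normrN gtr0_norm.
Qed.

(** * Chaining steps through disjoint zones *)

(** One zone of fresh rows is reserved for each of the [K] steps. *)
Definition zonemass (R : realType) (rho q : R) (K N L : nat)
    (c : 'I_K * ('I_N * 'I_L) -> R) : R :=
  \sum_(i < K) rowmass rho q (fun j => c (i, j)).

Lemma rowmass0 (R : realType) (rho q : R) (N L : nat) : 0 < rho -> 0 < q ->
  rowmass rho q (fun _ : 'I_N * 'I_L => 0) = 0.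
Proof.
move=> rho0 q0; rewrite /rowmass big1 // => b _.
by rewrite big1 ?powR0 ?gt_eqF ?divr_gt0 // => l _; rewrite normr0 powR0 ?gt_eqF.
Qed.

Lemma zonemassZ (R : realType) (rho q : R) (K N L : nat)
    (c : 'I_K * ('I_N * 'I_L) -> R) (s : R) : 0 < rho -> 0 < q -> 0 <= s ->
  zonemass rho q (fun j => s * c j) = s `^ rho * zonemass rho q c.
Proof.
move=> rho0 q0 s0; rewrite /zonemass /rowmass mulr_sumr; apply: eq_bigr => i _.
rewrite mulr_sumr; apply: eq_bigr => b _.
under eq_bigr => l _ do rewrite normrM powRM // (ger0_norm s0).
rewrite -mulr_sumr powRM ?powR_ge0 ?sumr_ge0 //.
by rewrite -powRrM mulrCA divff ?gt_eqF // mulr1.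
Qed.

(** By the bounded degree, the bound on small masses extends to masses up to two, with a constant
    independent of [K], [N] and [L]. Then [K] steps of mass [1/K] in distinct zones reach mass one,
    where [F] is at most [C0 * C / K < 1]. *)
Lemma no_separation (R : realType) (d : nat) (rho q r : R) :
  0 < rho -> 0 < q -> 0 < r ->
  (forall k l : nat, ~~ odd k -> k%:R = rho -> l%:R != rho / q) ->
  ~ (forall K N L : nat, exists F : ('I_K * ('I_N * 'I_L) -> R) -> R,
      [/\ polyform d F, F (fun _ => 0) = 0,
          forall c, zonemass rho q c < r -> `|F c| <= 1 &
          forall c, zonemass rho q c = 1 -> 1 <= F c]).
Proof.
move=> rho0 q0 r0 hres sep.
have [C0 C00 HC0] := one_step d rho0 q0 hres.
(* Scaling by [s <= t] brings masses up to [2] down to at most [2 * r / 3 < r]. *)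
pose t := (r / 3) `^ rho^-1.
have t0 : 0 < t by rewrite powR_gt0 ?divr_gt0 ?ltr0n.
have [C _ HC] := @polyform_bounded R d 1 t t0.
have [K K0n KC] : exists2 K : nat, (0 < K)%N & C0 * C / K%:R < 1.
  exists (Num.truncn (C0 * C)).+1 => //.
  by rewrite ltr_pdivrMr ?ltr0n // mul1r truncnS_gt.
have K0 : 0 < K%:R :> R by rewrite ltr0n.
have [N [L step]] := HC0 K K0n.
have [F [pF F0 Fsmall Fsep]] := sep K N L.
(* Mass two leaves room for a point and a perturbation, each of mass at most one. *)
have Fbound c : zonemass rho q c <= 2 -> `|F c| <= C.
  move=> c2; apply: HC => // s /andP[s0 st]; apply: Fsmall; rewrite zonemassZ //.
  have s3 : s `^ rho <= r / 3.
    have -> : r / 3 = t `^ rho.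
      by rewrite /t -powRrM mulVf ?gt_eqF // powRr1 // divr_ge0 // ltW.
    by apply: powR_le; [exact: ltW|exact: s0|exact: st].
  apply: (@le_lt_trans _ _ (r / 3 * 2)); last by lra.
  have z0 : 0 <= zonemass rho q c.
    by apply: sumr_ge0 => i _; apply: sumr_ge0 => b _; exact: powR_ge0.
  by rewrite ler_pM // powR_ge0.
have chain i : (i <= K)%N -> exists x : 'I_K * ('I_N * 'I_L) -> R,
    [/\ forall p : 'I_K * ('I_N * 'I_L), (i <= p.1)%N -> x p = 0, zonemass rho q x = i%:R / K%:R &
        F x <= i%:R * (C0 * C / K%:R ^+ 2)].
  elim: i => [_|i IH iK].
    exists (fun _ => 0); rewrite F0 !mul0r; split=> //.
    by rewrite /zonemass big1 // => i _; exact: rowmass0.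
  have [x [x0 xm Fx]] := IH (ltnW iK).
  pose o : 'I_K := Ordinal iK.
  (* Zone [o] of [x] is still empty, so the masses of [x] and [z] add up. *)
  pose ext z : 'I_K * ('I_N * 'I_L) -> R := fun p => x p + (p.1 == o)%:R * z p.2.
  have extm z : zonemass rho q (ext z) = i%:R / K%:R + rowmass rho q z.
    have split c : zonemass rho q c = rowmass rho q (fun j => c (o, j)) +
        \sum_(i' < K | i' != o) rowmass rho q (fun j => c (i', j)).
      by rewrite /zonemass (bigD1 o).
    rewrite -xm !split addrAC.
    have -> : (fun j => ext z (o, j)) = z.
      by apply/funext => j; rewrite /ext x0 //= eqxx add0r mul1r.
    have -> : (fun j => x (o, j)) = (fun _ => 0).
      by apply/funext => j; rewrite x0.
    rewrite (rowmass0 _ _ rho0 q0) (add0r (rowmass rho q z)).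
    apply: (congr1 (fun w => rowmass rho q z + w)); apply: eq_bigr => j jo.
    by congr (rowmass _ _ _); apply/funext => l; rewrite /ext /= (negbTE jo) mul0r addr0.
  have [| |z zm Fz] := step (fun z => F (ext z)) C.
  - exact: polyform_subst.
  - move=> z z1; apply: Fbound; rewrite extm.
    have : i%:R / K%:R <= 1 :> R by rewrite ler_pdivrMr // mul1r ler_nat ltnW.
    lra.
  exists (ext z); split.
  - move=> p ip; rewrite /ext x0 ?(ltnW ip) // add0r.
    by rewrite -val_eqE /= gtn_eqF // mul0r.
  - by rewrite extm zm -natr1 mulrDl mul1r.
  - apply: le_trans Fz _; rewrite -natr1 mulrDl mul1r lerD2r.
    rewrite (_ : ext _ = x) //; apply/funext => p.
    by rewrite /ext mulr0 addr0.
have [x [_ xm Fx]] := chain K (leqnn _).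
have := Fsep x; rewrite xm divff ?gt_eqF // => /(_ erefl) F1.
have : K%:R * (C0 * C / K%:R ^+ 2) = C0 * C / K%:R by field; rewrite gt_eqF.
by move=> e; rewrite e in Fx; have := le_lt_trans (le_trans F1 Fx) KC; rewrite ltxx.
Qed.

(** * Finitely supported sequences *)

Section FiniteSupport.
Variables (R : realType) (p q : R).
Hypotheses (p0 : 0 < p) (q0 : 0 < q).

Lemma powR_blocknorm (x : seqE R) (n : nat) :
  blocknorm q x n `^ p = (\sum_(i < n) `|x n i| `^ q) `^ (p / q).
Proof. by rewrite /blocknorm -powRrM mulrC. Qed.

Lemma blocknorm0 (x : seqE R) (n : nat) :
  (forall i, x n i = 0) -> blocknorm q x n `^ p = 0.
Proof.
move=> x0; rewrite powR_blocknorm big1 ?powR0 ?gt_eqF ?divr_gt0 // => i _.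
by rewrite x0 normr0 powR0 ?gt_eqF.
Qed.

Lemma psums_finite_support (x : seqE R) (n1 : nat) :
  (forall n i, (n1 <= n)%N -> x n i = 0) ->
  (psums p q x @ \oo --> \sum_(n < n1) blocknorm q x n `^ p)%classic.
Proof.
move=> x0; apply: cvg_near_cst; near=> n.
have n1n : (n1 <= n)%N by near: n; exact: nbhs_infty_ge.
rewrite /psums /series /= (big_cat_nat (n := n1)) //= big_mkord [X in _ + X]big1_seq ?addr0 //.
move=> k; rewrite mem_index_iota => /andP[_ /andP[n1k _]].
by rewrite blocknorm0 // => i; exact: x0.
Unshelve. all: by end_near. Qed.

Lemma inX_finite_support (x : seqE R) (n1 : nat) :
  (forall n i, (n1 <= n)%N -> x n i = 0) -> inX p q x.
Proof. by move=> /psums_finite_support h; apply/cvg_ex; eexists; exact: h. Qed.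

Lemma normX_finite_support (x : seqE R) (n1 : nat) :
  (forall n i, (n1 <= n)%N -> x n i = 0) ->
  normX p q x = (\sum_(n < n1) blocknorm q x n `^ p) `^ p^-1.
Proof. by move=> /psums_finite_support/cvg_lim h; rewrite /normX h. Qed.

End FiniteSupport.

(** * Multilinear forms on finite spans *)

Definition lincomb (R : realType) (I : Type) (u : I -> seqE R) (s : seq I) (c : I -> R)
  : seqE R := fun n i => \sum_(o <- s) c o * u o n i.

Section MultilinearExpansion.
Variables (R : realType) (p q : R) (I : finType) (u : I -> seqE R).
Hypothesis inXsum : forall (s : seq I) (c : I -> R),
  inX p q (lincomb u s c).

Let inXu o : inX p q (u o).
Proof.
have := @inXsum [:: o] (fun _ => 1).
rewrite (_ : lincomb _ _ _ = u o) //.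
by apply/functional_extensionality_dep => n; apply/funext => i; rewrite /lincomb big_seq1 mul1r.
Qed.

Lemma multilinear_sum (k : nat) (A : ('I_k -> seqE R) -> R) (v : 'I_k -> seqE R)
    (j : 'I_k) (s : seq I) (c : I -> R) :
  multilinear p q A -> (forall i, inX p q (v i)) ->
  A (upd v j (lincomb u s c)) =
  \sum_(o <- s) c o * A (upd v j (u o)).
Proof.
move=> Alin vX; elim: s => [|o s IH].
  rewrite big_nil.
  (* Linearity with both coefficients zero gives the value zero at the empty combination. *)
  have := Alin v j (v j) (v j) 0 0 vX (vX j) (vX j); rewrite !mul0r addr0 => <-.
  congr (A (upd _ _ _)).
  apply/functional_extensionality_dep => n; apply/funext => i.
  by rewrite /lincomb big_nil /addE /scaleE !mul0r addr0.
rewrite big_cons -IH -[X in _ + X]mul1r -Alin //.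
congr (A (upd _ _ _)).
apply/functional_extensionality_dep => n; apply/funext => i.
by rewrite /lincomb big_cons /addE /scaleE mul1r.
Qed.

(** The slots are filled one at a time: in [gen] the first [t] slots hold the combination and the
    others fixed vectors. Expanding one more slot contributes one variable. *)
Lemma multilinear_polyform (k : nat) (A : ('I_k -> seqE R) -> R) :
  multilinear p q A ->
  polyform k (fun c => A (fun _ => lincomb u (index_enum I) c)).
Proof.
move=> Alin.
suff gen t : (t <= k)%N -> forall v : 'I_k -> seqE R, (forall i, inX p q (v i)) ->
    polyform t (fun c => A (fun j => if (j < t)%N then
       lincomb u (index_enum I) c else v j)).
  have v0X (i : 'I_k) : inX p q (lincomb u [::] (fun _ => 1)).
    exact: (@inXsum [::] (fun _ => 1)).
  apply: eq_polyform (gen k (leqnn k) _ v0X) => c.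
  by congr (A _); apply/funext => j; rewrite ltn_ord.
elim: t => [_|t IH tk] v vX.
  exact: (polyform_cst _ 0 (A v)).
pose j0 : 'I_k := Ordinal tk.
have updX o : forall i, inX p q (upd v j0 (u o) i).
  by move=> i; rewrite /upd; case: ifP.
apply: eq_polyform (polyform_sum (index_enum I)
  (fun o => polyformX o (IH (ltnW tk) _ (updX o)))) => c.
rewrite /=; set w := lincomb _ _ _.
transitivity (A (upd (fun j : 'I_k => if (j < t)%N then w else v j) j0 w)); last first.
  congr (A _); apply/funext => j; rewrite /upd -val_eqE /= ltnS [(j <= t)%N]leq_eqVlt.
  by case: eqP.
have wX (i : 'I_k) : inX p q (if (i < t)%N then w else v i).
  by case: ifP => _; [exact: inXsum|exact: vX].
rewrite (multilinear_sum j0 (index_enum I) c Alin wX).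
apply: eq_bigr => o _; congr (_ * A _); apply/funext => j; rewrite /upd -val_eqE /=.
by case: eqP => // ->; rewrite ltnn.
Qed.

End MultilinearExpansion.

(** * Placing finite matrices in the sequence space *)

(** Positions are compared as naturals, so that no coordinate is cast between the types ['I_n]. *)
Definition place (R : realType) (I : finType) (blk pos : I -> nat) (c : I -> R) : seqE R :=
  fun n i => \sum_o c o * ((blk o == n) && (pos o == i))%:R.
Arguments place {R I} blk pos c n i.

Section Placement.
Variables (R : realType) (I : finType) (blk pos : I -> nat).
Hypothesis posblk : forall o, (pos o < blk o)%N.
Hypothesis inj : forall o o', blk o = blk o' -> pos o = pos o' -> o = o'.

(** By injectivity each position receives at most one coordinate, and empty positions contribute
    [G 0 = 0]. *)
Lemma sum_place (G : R -> R) (c : I -> R) (n : nat) : G 0 = 0 ->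
  \sum_(i < n) G (place blk pos c n i) = \sum_(o | blk o == n) G (c o).
Proof.
move=> G0.
have small o : blk o == n -> (pos o < n)%N by move/eqP <-.
(* Block [0] has no positions, and [inord] needs a nonempty ordinal type. *)
case: n small => [|n] small.
  rewrite big_ord0 big_pred0 // => o; apply/negP => /eqP o0.
  by have := posblk o; rewrite o0.
rewrite (partition_big (fun o => inord (pos o) : 'I_n.+1) predT) //=.
apply: eq_bigr => i _.
have E o : (blk o == n.+1) && (inord (pos o) == i) = (blk o == n.+1) && (pos o == i).
  case: (boolP (blk o == n.+1)) => // /small pn /=.
  by rewrite -val_eqE /= inordK.
under [RHS]eq_bigl do rewrite E.
have -> : place blk pos c n.+1 i =
    \sum_(o | (blk o == n.+1) && (pos o == i)) c o.
  rewrite /place [RHS]big_mkcond /=; apply: eq_bigr => o _.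
  by case: ifP; rewrite ?mulr1 ?mulr0.
case: (pickP (fun o => (blk o == n.+1) && (pos o == i))) => [ o /andP[/eqP bo /eqP po]|none].
  have E1 : (fun o => (blk o == n.+1) && (pos o == i)) =1 pred1 o.
    move=> o' /=; apply/andP/eqP => [[/eqP bo' /eqP po']|->]; last by rewrite bo po !eqxx.
    by apply: inj; congruence.
  by rewrite !(eq_bigl _ _ E1) !big_pred1_eq.
by rewrite !(eq_bigl _ _ none) !big_pred0_eq.
Qed.

Lemma place_support (c : I -> R) (n1 : nat) : (forall o, (blk o < n1)%N) ->
  forall n i, (n1 <= n)%N -> place blk pos c n i = 0.
Proof.
move=> b1 n i n1n; rewrite /place big1 // => o _.
by rewrite ltn_eqF ?mulr0 // (leq_trans (b1 o)).
Qed.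

Lemma normX_place (p q : R) (c : I -> R) (n1 : nat) : 0 < p -> 0 < q ->
  (forall o, (blk o < n1)%N) ->
  normX p q (place blk pos c) =
  (\sum_(n < n1) (\sum_(o | blk o == n) `|c o| `^ q) `^ (p / q)) `^ p^-1.
Proof.
move=> p0 q0 b1; rewrite (normX_finite_support p0 q0 (place_support c b1)).
congr (_ `^ _); apply: eq_bigr => n _; rewrite powR_blocknorm.
by rewrite (sum_place (G := fun x => `|x| `^ q)) // normr0 powR0 ?gt_eqF.
Qed.

End Placement.

(* Scattering the rows over distinct blocks gives [rho = p]; collecting all
   coordinates in a single block gives [rho = q]. *)
Lemma separating_exponent (R : realType) (p q rho : R) (P : seqE R -> R) :
  0 < p -> 0 < q -> 0 < rho -> separating_polynomial p q P ->
  (forall K N L : nat, exists blk pos : 'I_K * ('I_N * 'I_L) -> nat,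
     [/\ exists n1, forall o, (blk o < n1)%N &
      forall c, normX p q (place blk pos c) = zonemass rho q c `^ rho^-1]) ->
  exists k l : nat, [/\ ~~ odd k, k%:R = rho & l%:R = rho / q].
Proof.
move=> p0 q0 rho0 [[d [A [Alin PA]]] Pc P0 Psep] emb.
apply: contrapT => none.
have X0 : inX p q (zeroE R) by apply: (inX_finite_support p0 q0 (n1 := 0)).
(* Continuity at [0] bounds [P] by [1] on the ball of radius [r], that is, for masses below
   [r ^ rho]. *)
have [r r0 Hr] := Pc _ X0 1 ltr01.
apply: (@no_separation R d rho q (r `^ rho) rho0 q0 (powR_gt0 _ r0)).
  by move=> k l ko kr; apply/negP => /eqP lr; apply: none; exists k, l.
move=> K N L; have [blk [pos [[n1 b1] E]]] := emb K N L.
have placeX c : inX p q (place blk pos c).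
  exact: (inX_finite_support p0 q0 (place_support pos c b1)).
exists (fun c => P (place blk pos c)); split.
- apply: (@eq_polyform R _ d (fun c => \sum_(k < d.+1) A k (fun _ => place blk pos c))).
    by move=> c; exact: (esym (PA _ (placeX c))).
  apply: polyform_sum => k.
  pose e o : seqE R := fun n i => ((blk o == n) && (pos o == i))%:R.
  have eX s c : inX p q (lincomb e s c).
    apply: (inX_finite_support p0 q0 (n1 := n1)) => n i n1n.
    rewrite /lincomb big1 // => o _.
    by rewrite /e ltn_eqF ?mulr0 // (leq_trans (b1 o)).
  have kd : (k <= d)%N by rewrite -ltnS.
  exact: (polyform_le kd (multilinear_polyform eX (Alin k))).
- apply: etrans P0; congr (P _).
  apply/functional_extensionality_dep => n; apply/funext => i.
  by rewrite /place big1 // => o _; rewrite mul0r.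
- move=> c cr; have := Hr _ (placeX c); rewrite P0 subr0 => H; apply/ltW/H => {H}.
  have -> : subE (place blk pos c) (zeroE R) = place blk pos c.
    by apply/functional_extensionality_dep => n; apply/funext => i; rewrite /subE subr0.
  have -> : r = (r `^ rho) `^ rho^-1.
    by rewrite -powRrM divff ?gt_eqF // powRr1 // ltW.
  rewrite E gt0_ltr_powR ?invr_gt0 ?nnegrE ?powR_ge0 //.
  by apply: sumr_ge0 => i _; apply: sumr_ge0 => b _; exact: powR_ge0.
- by move=> c c1; apply: (Psep _ (placeX c)); rewrite E c1 powR1.
Qed.

Lemma place_one_block (R : realType) (p q : R) (K N L : nat) : 0 < p -> 0 < q ->
  exists blk pos : 'I_K * ('I_N * 'I_L) -> nat,
     [/\ exists n1, forall o, (blk o < n1)%N &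
      forall c, normX p q (place blk pos c) = zonemass q q c `^ q^-1].
Proof.
(* Block [n0] has dimension [n0], exactly the number of coordinates. *)
move=> p0 q0; pose n0 := #|{: 'I_K * ('I_N * 'I_L)}|.
pose blk (_ : 'I_K * ('I_N * 'I_L)) := n0.
pose pos (o : 'I_K * ('I_N * 'I_L)) : nat := enum_rank o.
have b1 o : (blk o < n0.+1)%N by [].
exists blk, pos; split; first by exists n0.+1.
move=> c; rewrite (normX_place _ _ c p0 q0 b1); last 2 first.
- by move=> o; exact: ltn_ord.
- by move=> o o' _ /val_inj/enum_rank_inj.
rewrite big_ord_recr /= big1 ?add0r; last first.
  move=> n _; rewrite big1 ?powR0 ?gt_eqF ?divr_gt0 // => o /eqP no.
  by have := ltn_ord n; rewrite -no ltnn.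
rewrite -powRrM mulrAC divff ?gt_eqF // mul1r; congr (_ `^ _).
rewrite (eq_bigl predT); last by move=> o; rewrite /blk eqxx.
rewrite /zonemass /rowmass divff ?gt_eqF //.
transitivity (\sum_(i < K) \sum_(b < N) \sum_(l < L) `|c (i, (b, l))| `^ q).
  under [RHS]eq_bigr => i _ do rewrite pair_bigA.
  by rewrite pair_bigA /=; apply: eq_bigr => -[i [b l]].
apply: eq_bigr => i _; apply: eq_bigr => b _; rewrite powRr1 //.
by apply: sumr_ge0 => l _; exact: powR_ge0.
Qed.

Lemma place_rows (R : realType) (p q : R) (K N L : nat) : 0 < p -> 0 < q ->
  exists blk pos : 'I_K * ('I_N * 'I_L) -> nat,
     [/\ exists n1, forall o, (blk o < n1)%N &
      forall c, normX p q (place blk pos c) = zonemass p q c `^ p^-1].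
Proof.
move=> p0 q0.
(* The shift by [L] makes every block used large enough for a row of length [L]. *)
pose blk (o : 'I_K * ('I_N * 'I_L)) := (L + enum_rank (o.1, o.2.1))%N.
pose pos (o : 'I_K * ('I_N * 'I_L)) : nat := o.2.2.
have b1 o : (blk o < L + #|{: 'I_K * 'I_N}|)%N by rewrite ltn_add2l.
exists blk, pos; split; first by eexists; exact: b1.
move=> c; rewrite (normX_place _ _ c p0 q0 b1); last 2 first.
- by move=> o; rewrite /blk /pos ltn_addr.
- move=> [i [b l]] [i' [b' l']] /addnI/val_inj/enum_rank_inj /= [-> ->].
  by move/val_inj => /= ->.
congr (_ `^ _); rewrite big_split_ord /= big1 ?add0r; last first.
  move=> n _; rewrite big1 ?powR0 ?gt_eqF ?divr_gt0 // => o /eqP no.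
  by have := ltn_ord n; rewrite -no /blk ltnNge leq_addr.
rewrite /zonemass /rowmass pair_bigA /=.
rewrite (reindex (@enum_rank _)) /=; last exact/onW_bij/enum_rank_bij.
apply: eq_bigr => -[i b] _ /=; congr (_ `^ _).
rewrite (reindex_onto (fun l : 'I_L => (i, (b, l))) (fun o => o.2.2)) /=.
  by apply: eq_bigl => l; rewrite /blk /= !eqxx.
move=> [i' [b' l]]; rewrite /blk eqn_add2l => /eqP/val_inj/enum_rank_inj /=.
by case=> -> ->.
Qed.

(** The choice [rho = p] gives the parity of [p] and the integrality of [p / q]; the choice
    [rho = q] gives the parity of [q]. *)
Lemma separating_even (R : realType) (p q : R) (P : seqE R -> R) :
  0 < p -> 0 < q -> separating_polynomial p q P ->
  even_integer p /\ even_integer q /\ exists k : nat, p = k%:R * q.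
Proof.
move=> p0 q0 sepP.
have even (k : nat) : ~~ odd k -> even_integer (k%:R : R).
  by move=> ko; exists k./2; rewrite mul2n even_halfK.
have [k [l [ko kp lpq]]] := separating_exponent p0 q0 p0 sepP
  (fun K N L => place_rows K N L p0 q0).
have [k' [_ [k'o k'q _]]] := separating_exponent p0 q0 q0 sepP
  (fun K N L => place_one_block K N L p0 q0).
split; first by rewrite -kp; exact: even.
split; first by rewrite -k'q; exact: even.
by exists l; rewrite lpq divfK ?gt_eqF.
Qed.

(** * The norm power as a separating polynomial *)

Lemma powR_gt1 (R : realType) (r c : R) : 0 < r -> 1 < c -> 1 < c `^ r.
Proof.
move=> r0 c1; have := @gt0_ltr_powR R r r0 1 c.
by rewrite !nnegrE powR1 ler01 (le_trans ler01 (ltW c1)); apply.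
Qed.

Lemma cvg_series_lin (R : realType) (f g : nat -> R) (a b : R) :
  cvgn (series f) -> cvgn (series g) ->
  cvgn (series (fun n => a * f n + b * g n)) /\
  limn (series (fun n => a * f n + b * g n)) =
    a * limn (series f) + b * limn (series g).
Proof.
move=> cf cg; have -> : (fun n => a * f n + b * g n) = (a *: f + b *: g) by [].
have caf := is_cvg_seriesZ (k := a) cf; have cbg := is_cvg_seriesZ (k := b) cg.
split; first exact: is_cvg_seriesD.
by rewrite lim_seriesD // !lim_seriesZ.
Qed.

(** With [s = c ^ (1/r)], either [b <= (s - 1) * a] and [a + b <= s * a], or [a < b / (s - 1)]. A
    leading constant as close to [1] as desired serves both closure under addition and
    continuity. *)
Lemma powR_add_le (R : realType) (r c : R) : 0 < r -> 1 < c ->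
  exists2 D : R, 0 <= D & forall a b : R, 0 <= a -> 0 <= b ->
    (a + b) `^ r <= c * a `^ r + D * b `^ r.
Proof.
move=> r0 c1; have c0 : 0 < c by lra.
pose s := c `^ r^-1; have s1 : 1 < s.
  by rewrite powR_gt1 // invr_gt0.
have sr : s `^ r = c by rewrite -powRrM mulVf ?gt_eqF // powRr1 // ltW.
have s10 : 0 < s - 1 by lra.
exists ((1 + (s - 1)^-1) `^ r); first exact: powR_ge0.
have e0 : 0 < 1 + (s - 1)^-1 by rewrite addr_gt0 ?invr_gt0.
move=> a b a0 b0; have [ba|ab] := leP b ((s - 1) * a).
- rewrite -[leLHS]addr0 lerD ?mulr_ge0 ?powR_ge0 // -sr -powRM //; last by lra.
  by apply: powR_le; [exact: ltW|exact: addr_ge0|nra].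
- rewrite -[leLHS]add0r lerD ?mulr_ge0 ?powR_ge0 // ?(ltW c0) // -powRM // ?(ltW e0) //.
  apply: powR_le; [exact: ltW|exact: addr_ge0|].
  rewrite mulrDl mul1r addrC lerD2l mulrC ler_pdivlMr //.
  by rewrite mulrC ltW.
Qed.

(** [Nx], [Ny], [Nz] stand for the [p]-th powers of the norms of [x], [y] and [y - x]. *)
Lemma almost_subadditive_dist (R : realType) (e eta D Nx Ny Nz : R) :
  0 < eta -> eta <= 1 -> eta * Nx <= e / 8 -> 0 <= D -> 0 <= Nx -> 0 <= Nz ->
  (D + 1) * Nz < e / 4 ->
  Ny <= (1 + eta) * Nx + D * Nz -> Nx <= (1 + eta) * Ny + D * Nz ->
  `|Ny - Nx| < e.
Proof.
move=> eta0 eta1 etaN D0 Nx0 Nz0 DN H1 H2.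
have DNz0 : 0 <= D * Nz by rewrite mulr_ge0.
have Dz : D * Nz < e / 4 by lra.
(* [Ny] is first bounded through [Nx], since [eta] is only chosen to control [eta * Nx]. *)
have etaNy : eta * Ny <= e / 2.
  have : eta * Ny <= eta * ((1 + eta) * Nx + D * Nz) by rewrite ler_wpM2l ?(ltW eta0).
  have -> : eta * ((1 + eta) * Nx + D * Nz) = (1 + eta) * (eta * Nx) + eta * (D * Nz) by ring.
  have : (1 + eta) * (eta * Nx) <= 2 * (e / 8).
    by rewrite ler_pM // ?mulr_ge0 ?(ltW eta0) //; lra.
  have : eta * (D * Nz) <= 1 * (e / 4) by rewrite ler_pM ?(ltW eta0) ?(ltW Dz).
  lra.
by rewrite ltr_norml; apply/andP; split; lra.
Qed.

(** * Closure under addition and continuity of the [p]-th power of the norm *)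

Section SequenceSpace.
Variables (R : realType) (p q : R).
Hypotheses (p0 : 0 < p) (q0 : 0 < q).

Let B (x : seqE R) n := blocknorm q x n `^ p.

Let B_ge0 x n : 0 <= B x n. Proof. exact: powR_ge0. Qed.

Lemma block_add_le (c : R) : 1 < c -> exists2 D : R, 0 <= D &
  forall (x y : seqE R) n, B (addE x y) n <= c * B x n + D * B y n.
Proof.
move=> c1; have c0 : 0 < c by lra.
have pq0 : 0 < p / q by rewrite divr_gt0.
(* The constant [c = s * s] is shared between the outer power [p / q] and the inner power [q], whose
   constant [t] becomes [s] under the outer one. *)
have [s s1 ss] : exists2 s : R, 1 < s & s * s = c.
  exists (c `^ 2^-1); first by rewrite powR_gt1 // invr_gt0.
  rewrite -powRD ?(gt_eqF c0) ?implybT //.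
  by rewrite (_ : 2^-1 + 2^-1 = 1 :> R) ?powRr1 ?ltW //; lra.
have [t t1 tr] : exists2 t : R, 1 < t & t `^ (p / q) = s.
  exists (s `^ (p / q)^-1); first by rewrite powR_gt1 // invr_gt0.
  by rewrite -powRrM mulVf ?gt_eqF // powRr1 //; lra.
have [D1 D10 H1] := powR_add_le q0 t1.
have [D2 D20 H2] := powR_add_le pq0 s1.
exists (D2 * D1 `^ (p / q)); first by rewrite mulr_ge0 ?powR_ge0.
move=> x y n.
have t0 : 0 <= t by lra.
have S0 (z : seqE R) : 0 <= \sum_(i < n) `|z n i| `^ q.
  by apply: sumr_ge0 => i _; exact: powR_ge0.
have BE (z : seqE R) : B z n = (\sum_(i < n) `|z n i| `^ q) `^ (p / q).
  exact: powR_blocknorm.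
rewrite !BE.
have -> : c * (\sum_(i < n) `|x n i| `^ q) `^ (p / q) =
    s * (t * \sum_(i < n) `|x n i| `^ q) `^ (p / q).
  by rewrite powRM // tr mulrA ss.
have -> : D2 * D1 `^ (p / q) * (\sum_(i < n) `|y n i| `^ q) `^ (p / q) =
    D2 * (D1 * \sum_(i < n) `|y n i| `^ q) `^ (p / q).
  by rewrite (powRM _ D10) // mulrA.
apply: le_trans (H2 _ _ (mulr_ge0 t0 (S0 x)) (mulr_ge0 D10 (S0 y))).
apply: powR_le; [exact: ltW|exact: S0|].
rewrite !mulr_sumr -big_split /=; apply: ler_sum => i _.
apply: le_trans (H1 _ _ (normr_ge0 _) (normr_ge0 _)).
by apply: powR_le; rewrite ?(ltW q0) // ler_normD.
Qed.

Lemma inX_dominated (x : seqE R) (v : nat -> R) :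
  (forall n, B x n <= v n) -> cvgn (series v) -> inX p q x.
Proof.
move=> Bv; apply: series_le_cvg => // n; first exact: powR_ge0.
exact: le_trans (B_ge0 x n) (Bv n).
Qed.

Lemma lim_psums_add_le (c : R) : 1 < c -> exists2 D : R, 0 <= D &
  forall x y : seqE R, inX p q x -> inX p q y -> inX p q (addE x y) /\
    limn (psums p q (addE x y)) <= c * limn (psums p q x) + D * limn (psums p q y).
Proof.
move=> c1; have [D D0 HD] := block_add_le c1; exists D; first exact: D0.
move=> x y xX yX.
have [cv lv] := cvg_series_lin c D xX yX.
have xyX : inX p q (addE x y) by exact: inX_dominated (HD x y) cv.
split; first exact: xyX.
by rewrite -lv; apply: (lim_series_le xyX cv); exact: HD.
Qed.

Lemma inX_add (x y : seqE R) : inX p q x -> inX p q y -> inX p q (addE x y).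
Proof.
move=> xX yX; have [D _ H] := @lim_psums_add_le 2 (ltr1n _ 2).
by have [] := H x y xX yX.
Qed.

Lemma psums_eq_norm (x y : seqE R) : (forall n i, `|x n i| = `|y n i|) ->
  psums p q x = psums p q y.
Proof.
move=> xy; have E n : blocknorm q x n = blocknorm q y n.
  apply: (congr1 (fun s => s `^ q^-1)).
  by apply: eq_bigr => i _; rewrite xy.
apply: (congr1 (fun u : nat -> R => series u)); apply/funext => n.
by rewrite E.
Qed.

Lemma lim_psums_ge0 (x : seqE R) : inX p q x -> 0 <= limn (psums p q x).
Proof.
move=> xX; apply: limr_ge => //; near=> n.
by apply: sumr_ge0 => i _; exact: powR_ge0.
Unshelve. all: by end_near. Qed.

Lemma lim_psumsE (x : seqE R) : inX p q x ->
  limn (psums p q x) = normX p q x `^ p.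
Proof.
by move=> xX; rewrite /normX -powRrM mulVf ?gt_eqF // powRr1 // lim_psums_ge0.
Qed.

(** Near-subadditivity is applied to both [y = x + z] and [x = y + (- z)], with [z] small. *)
Lemma continuous_lim_psums : continuousX p q (fun x => limn (psums p q x)).
Proof.
move=> x xX e e0; pose Nx := limn (psums p q x).
have Nx0 : 0 <= Nx := lim_psums_ge0 xX.
pose eta := Num.min 1 (e / (8 * (Nx + 1))).
have eta0 : 0 < eta by rewrite lt_min ltr01 divr_gt0 // mulr_gt0 //; lra.
have eta1 : eta <= 1 by rewrite ge_min lexx.
have etaN : eta * Nx <= e / 8.
  apply: (@le_trans _ _ (eta * (Nx + 1))); first nra.
  have : eta <= e / (8 * (Nx + 1)) by rewrite ge_min lexx orbT.
  rewrite invfM mulrA ler_pdivlMr //; lra.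
have [|D D0 HD] := @lim_psums_add_le (1 + eta); first by lra.
have D1 : 0 < D + 1 by lra.
have [h h0 hD] : exists2 h : R, 0 < h & (D + 1) * h = e / 4.
  exists (e / (4 * (D + 1))); first by rewrite divr_gt0 // mulr_gt0 //; lra.
  by field; lra.
exists (h `^ p^-1); first exact: powR_gt0.
move=> y yX; rewrite /=; set z := subE y x => zh.
pose z' : seqE R := fun n i => - z n i.
have negE : psums p q z' = psums p q z.
  by apply: psums_eq_norm => n i; rewrite normrN.
have zX : inX p q z.
  pose x' : seqE R := fun n i => - x n i.
  have x'E : psums p q x' = psums p q x.
    by apply: psums_eq_norm => n i; rewrite normrN.
  have x'X : inX p q x' by rewrite /inX x'E; exact: xX.
  exact: (inX_add yX x'X).
have z'X : inX p q z' by rewrite /inX negE; exact: zX.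
have yE : y = addE x z.
  by apply/functional_extensionality_dep => n; apply/funext => i; rewrite /addE /z /subE; ring.
have xE : x = addE y z'.
  by apply/functional_extensionality_dep => n; apply/funext => i; rewrite /addE /z' /z /subE; ring.
have Nz0 : 0 <= limn (psums p q z) := lim_psums_ge0 zX.
have Nzh : limn (psums p q z) < h.
  have hE : h = (h `^ p^-1) `^ p.
    by rewrite -powRrM (mulVf (lt0r_neq0 p0)) (powRr1 (ltW h0)).
  have n0 : 0 <= normX p q z by exact: powR_ge0.
  rewrite (lim_psumsE zX) hE.
  apply: (gt0_ltr_powR p0 _ _ zh); first by rewrite nnegrE.
  by rewrite nnegrE powR_ge0.
have DN : (D + 1) * limn (psums p q z) < e / 4.
  by rewrite -hD ltr_pM2l.
have [_ H1] := HD x z xX zX; rewrite -yE in H1.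
have [_ H2] := HD y z' yX z'X; rewrite -xE negE in H2.
exact: (almost_subadditive_dist eta0 eta1 etaN D0 Nx0 Nz0 DN H1 H2).
Qed.

End SequenceSpace.

(* In block [n], the polarization of [(\sum_i x_i ^ q) ^ k.+1]: the [k.+1 * q]
   slots are grouped by [q], and [f] selects one coordinate per group. *)
Definition blockform (R : realType) (k q m : nat) (v : 'I_m -> seqE R) (n : nat) : R :=
  \sum_(f : {ffun 'I_k.+1 -> 'I_n}) \prod_(j < m) v j n (f (inord (j %/ q))).

Lemma prod_div_group (R : comNzRingType) (k q : nat) (g : nat -> R) : (0 < q)%N ->
  \prod_(j < k * q) g (j %/ q)%N = \prod_(a < k) g a ^+ q.
Proof.
move=> q0; elim: k => [|k IH]; first by rewrite !big_ord0.
rewrite -(big_mkord xpredT (fun j => g (j %/ q)%N)) mulSnr.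
rewrite (big_cat_nat (n := (k * q)%N)) ?leq_addr //= !big_mkord IH big_ord_recr /=.
congr (_ * _).
rewrite -{1}[(k * q)%N]add0n big_addn addKn big_mkord.
rewrite (eq_bigr (fun _ => g k)); first by rewrite prodr_const card_ord.
by move=> i _; rewrite divnDr ?dvdn_mull // mulnK // divn_small.
Qed.

(** * A multilinear form for the [p]-th power of the norm *)

Section ReverseDirection.
Variables (R : realType) (k q : nat).
Hypotheses (q0 : (0 < q)%N) (qeven : ~~ odd q).

Let Q : R := q%:R.
Let P : R := k.+1%:R * Q.
Let Q0 : 0 < Q. Proof. by rewrite ltr0n. Qed.
Let P0 : 0 < P. Proof. by rewrite mulr_gt0. Qed.

(** As [q] is even, absolute values disappear in the [q]-th powers; the power [k.+1] of their sum
    then expands over the choice functions [f]. *)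
Lemma blockform_diag (x : seqE R) (n : nat) :
  blockform k q (fun _ : 'I_(k.+1 * q) => x) n = blocknorm Q x n `^ P.
Proof.
rewrite powR_blocknorm /P mulfK ?gt_eqF // powR_mulrn; last first.
  by apply: sumr_ge0 => i _; exact: powR_ge0.
have qE : q = (2 * q./2)%N by rewrite mul2n even_halfK.
have -> : \sum_(i < n) `|x n i| `^ Q = \sum_(i < n) x n i ^+ q.
  apply: eq_bigr => i _; rewrite powR_mulrn //.
  by rewrite qE !exprM real_normK ?num_real.
rewrite -[k.+1 in RHS]card_ord -prodr_const bigA_distr_bigA /blockform /=.
apply: eq_bigr => f _.
rewrite (prod_div_group (q := q) k.+1 (fun a => x n (f (inord a)))) //.
by apply: eq_bigr => a _; rewrite inord_val.
Qed.

Lemma blockform_upd (m : nat) (v : 'I_m -> seqE R) (j : 'I_m) (y z : seqE R)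
    (a b : R) (n : nat) :
  blockform k q (upd v j (addE (scaleE a y) (scaleE b z))) n =
  a * blockform k q (upd v j y) n + b * blockform k q (upd v j z) n.
Proof.
rewrite /blockform !mulr_sumr -big_split /=; apply: eq_bigr => f _.
rewrite (bigD1 j) //= [in X in _ = a * X + _](bigD1 j) //= [in X in _ = _ + b * X](bigD1 j) //=.
have E w : \prod_(i < m | i != j) @upd R m v j w i n (f (inord (i %/ q))) =
    \prod_(i < m | i != j) v i n (f (inord (i %/ q))).
  by apply: eq_bigr => i /negbTE ij; rewrite /upd ij.
by rewrite !E /upd eqxx /addE /scaleE mulrDl !mulrA.
Qed.

Lemma blockform_le (m : nat) (v : 'I_m -> seqE R) (n : nat) :
  `|blockform k q v n| <= blockform k q (fun _ : 'I_m => (fun n' i => \sum_j `|v j n' i|)) n.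
Proof.
apply: le_trans (ler_norm_sum _ _ _) _; apply: ler_sum => f _.
rewrite normr_prod; apply: ler_prod => j _; rewrite normr_ge0 /=.
by rewrite (bigD1 j) //= lerDl sumr_ge0.
Qed.

Lemma inX_sum_norm (m : nat) (v : 'I_m -> seqE R) : (forall j, inX P Q (v j)) ->
  inX P Q (fun n i => \sum_j `|v j n i|).
Proof.
move=> vX; pose w (s : seq 'I_m) : seqE R := fun n i => \sum_(j <- s) `|v j n i|.
suff wX s : inX P Q (w s) by exact: (wX (index_enum _)).
elim: s => [|j s IH].
  apply: (inX_finite_support P0 Q0 (n1 := 0)) => n i _.
  by rewrite /w big_nil.
pose vj : seqE R := fun n i => `|v j n i|.
have vjE : psums P Q vj = psums P Q (v j).
  by apply: psums_eq_norm => n i; rewrite normr_id.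
have vjX : inX P Q vj by rewrite /inX vjE; exact: (vX j).
have -> : w (j :: s) = addE vj (w s).
  by apply/functional_extensionality_dep => n; apply/funext => i; rewrite /w big_cons.
exact: (inX_add P0 Q0 vjX IH).
Qed.

(** Absolute convergence, by comparison with the diagonal value at the sum of the absolute values of
    the [v j], which lies in the space. *)
Lemma cvg_blockform (v : 'I_(k.+1 * q) -> seqE R) : (forall j, inX P Q (v j)) ->
  cvgn (series (blockform k q v)).
Proof.
move=> vX; apply: normed_cvg.
apply: series_le_cvg (inX_sum_norm vX) => n.
- exact: normr_ge0.
- exact: powR_ge0.
- by rewrite -blockform_diag; exact: blockform_le.
Qed.

Lemma separating_lim_psums : separating_polynomial P Q (fun x => limn (psums P Q x)).
Proof.
(* All forms vanish except in degree [k.+1 * q]: the polynomial is homogeneous. *)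
pose A m (v : 'I_m -> seqE R) : R :=
  if m == (k.+1 * q)%N then limn (series (blockform k q v)) else 0.
split.
- exists (k.+1 * q)%N, A; split.
    move=> m v j y z a b vX yX zX; rewrite /A.
    case: eqP => [mE|_]; last by rewrite !mulr0 addr0.
    subst m.
    have updX w : inX P Q w -> forall i, inX P Q (upd v j w i).
      by move=> wX i; rewrite /upd; case: ifP => _; [exact: wX|exact: vX].
    have [_ <-] := cvg_series_lin a b (cvg_blockform (updX y yX)) (cvg_blockform (updX z zX)).
    by congr (limn (series _)); apply/funext => n; exact: blockform_upd.
  move=> x xX; rewrite big_ord_recr /= big1 ?add0r.
    rewrite /A eqxx; congr (limn (series _)); apply/funext => n.
    by rewrite blockform_diag.
  by move=> m _; rewrite /A ltn_eqF.
- exact: continuous_lim_psums.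
- have zE n (i : 'I_n) : (0 <= n)%N -> @zeroE R n i = 0 by [].
  by rewrite (cvg_lim _ (psums_finite_support P0 Q0 (n1 := 0) (fun n i => @zE n i))) // big_ord0.
- by move=> x xX x1; rewrite (lim_psumsE P0 xX) x1 powR1.
Qed.

End ReverseDirection.

Theorem theorem3p2 (R : realType) (p q : R) (hp : 1 < p) (hq : 1 < q) :
  (exists P : seqE R -> R, separating_polynomial p q P) <->
  (even_integer p /\ even_integer q /\ exists k : nat, p = k%:R * q).
Proof.
have p0 : 0 < p := lt_trans ltr01 hp.
have q0 : 0 < q := lt_trans ltr01 hq.
split=> [[P sepP]|[_ [[m qm] [[|k] pk]]]]; first exact: separating_even sepP.
  by rewrite pk mul0r ltxx in p0.
exists (fun x => limn (psums p q x)); subst p q.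
apply: separating_lim_psums; first by rewrite -(ltr0n R).
by rewrite oddM.
Qed.
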